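(* Let $\mathbb{K}$ be a countably infinite field, and let $E\subset\mathbb{K}$ be a set with positive upper Banach density. Then, for every Laurent polynomial of the form $$p(X)=\sum_{k=-N}^{N}p_kX^k\quad\text{with }p_0=0$$ (with coefficients $p_k\in\mathbb{K}$), there exists $a\in\mathbb{K}^*$ such that $p(a)\in E-E$.
   Context: Here $E-E=\{e-e':e,e'\in E\}$. Upper Banach density is taken in the additive group $(\mathbb{K},+)$: a Følner sequence is a sequence $(F_n)$ of non-empty finite subsets of $\mathbb{K}$ with $|F_n\cap(F_n+b)|/|F_n|\to1$ for every $b\in\mathbb{K}$, and $d^*(E)=\sup_{(F_n)}\limsup_{n\to\infty}|E\cap F_n|/|F_n|$, the supremum being over all such sequences. *)

(* Defs.v *)
From mathcomp Require Import all_boot all_order all_algebra finmap.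
From mathcomp Require Import all_classical all_reals all_analysis.

Set Implicit Arguments.
Unset Strict Implicit.
Unset Printing Implicit Defensive.

Import Order.TTheory GRing.Theory Num.Theory.
Import numFieldNormedType.Exports.

Local Open Scope classical_set_scope.
Local Open Scope fset_scope.
Local Open Scope ring_scope.

Definition fset_shift (K : fieldType) (F : {fset K}) (b : K) : {fset K} :=
  [fset x + b | x in F].

(* |A| / |F| as a real number. *)
Definition fset_ratio (K : fieldType) (R : realType) (A F : {fset K}) : R :=
  (#|` A|)%:R / (#|` F|)%:R.

Definition folner (K : fieldType) (R : realType) (F : nat -> {fset K}) : Prop :=
  (forall n, F n != fset0) /\
  (forall b : K,
    (fun n => fset_ratio R (F n `&` fset_shift (F n) b) (F n)) @ \oo --> (1 : R)).

(* The supremum and the limsup are taken in \bar R, where both always exist. *)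
Definition upper_banach_density (K : fieldType) (R : realType) (E : set K)
    : \bar R :=
  ereal_sup
    [set limn_esup (fun n => (fset_ratio R [fset x in F n | x \in E] (F n))%:E)
       | F in [set F : nat -> {fset K} | folner R F]].

(* Value at a != 0 of the Laurent polynomial sum_(-N <= k <= N) p_k X^k,
   reindexed by k = i - N; p k is only read for -N <= k <= N. *)
Definition laurent_eval (K : fieldType) (N : nat) (p : int -> K) (a : K) : K :=
  \sum_(i < N.*2.+1) p (i%:Z - N%:Z) * a ^ (i%:Z - N%:Z).

Definition difference_set (K : fieldType) (E : set K) : set K :=
  [set e - e' | e in E & e' in E].

(* Main.v *)
Require Import Defs.
From mathcomp Require Import all_boot all_order all_algebra finmap.
From mathcomp Require Import all_classical all_reals all_analysis.
From mathcomp Require Import ring lra zify.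

Set Implicit Arguments.
Unset Strict Implicit.
Unset Printing Implicit Defensive.

Import Order.TTheory GRing.Theory Num.Theory.
Import numFieldNormedType.Exports.

Local Open Scope classical_set_scope.
Local Open Scope ring_scope.

(**
Suppose that no value p(a), a <> 0, lies in E - E.  Let L be a translation
invariant mean on K with L(1_E) = d > 0, and put f = 1_E - d.  The correlation
y |-> L (f(x) f(x + y)) is positive definite on (K, +), and it equals - d ^ 2
at every p(a).  The theorem says that this is impossible.

In characteristic l the maps x |-> x ^ (l ^ n) are additive, so
p(b) = ell ((b ^ k)_k) for an additive map ell on a finite power V of K, where
only exponents k that are nonzero in K occur ([laurent_core]).  Pulling the
correlation back along ell and averaging over the action
(y_k) |-> (b ^ k y_k) of the multiplicative group gives a positive definite
function phi on V that is invariant under this torus, and phi (1, ..., 1) =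
- d ^ 2.  It therefore suffices to show that a torus invariant positive definite
function is nonnegative at (1, ..., 1): [torus_invariant_ge0].

Read phi (y) as <U_y v, v> for a unitary representation U of V.  Let k be a
weight of maximal absolute value.  The component of v that is fixed by the k-th
axis contributes a function that depends on fewer coordinates, and induction
applies to it.  For the orthogonal component, whose mean along the k-th axis is
zero, the value at (1, ..., 1) vanishes ([mixing_vanish]).  These two components
are separated by averaging along the axis ([avg_along_posdef],
[sub_avg_along_posdef]).

The vanishing rests on Bessel's inequality: if infinitely many vectors have the
same inner product c with v and are pairwise orthogonal, then c = 0
([generic_orthogonality]).  It is applied to curves h |-> y (h) in V, with
phi (y (h)) averaged over h by an affine invariant mean.  Substituting e ^ (- k) h
for h and acting by e ^ j leaves the monomial h ^ j of weight k unchanged and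
multiplies any other monomial by some power of e.  Hence the difference of two such
transforms has one monomial less, and the transforms are as good as orthogonal
once that shorter difference is known to have mean zero.  All monomials can be
removed in this way except the linear one of maximal weight, whose mean is zero
by assumption ([poly_curve_mean]).  The curve b = 1 / (1 + h) thus handles points
with coordinates of negative weight only ([one_signed]).  When both signs occur,
along b = 1 + h the coordinates of positive weight are polynomials and can be
removed, while the coordinate of maximal negative weight keeps a pole and so is
still nonzero when only negative weights remain ([mixed_curve_mean]).
*)

(** * Means *)

Section Means.
Context {R : realType}.

Definition bdd (T : Type) (f : T -> R) := exists C, forall x, `|f x| <= C.

Lemma bdd_lin (T : Type) (a : R) (f g : T -> R) :
  bdd f -> bdd g -> bdd (fun x => a * f x + g x).
Proof.
move=> [C hC] [D hD]; exists (`|a| * C + D) => x.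
by rewrite (le_trans (ler_normD _ _))// lerD// normrM ler_wpM2l.
Qed.

Lemma bdd_cst (T : Type) (a : R) : bdd (fun _ : T => a).
Proof. by exists `|a|. Qed.

Lemma bddD (T : Type) (f g : T -> R) :
  bdd f -> bdd g -> bdd (fun x => f x + g x).
Proof.
move=> bf bg; have := bdd_lin 1 bf bg.
by congr bdd; apply/funext => x; rewrite mul1r.
Qed.

Lemma bddZ (T : Type) a (f : T -> R) : bdd f -> bdd (fun x => a * f x).
Proof.
move=> bf; have := bdd_lin a bf (bdd_cst T 0).
by congr bdd; apply/funext => x; rewrite addr0.
Qed.

Lemma bddN (T : Type) (f : T -> R) : bdd f -> bdd (fun x => - f x).
Proof.
by move=> /(bddZ (-1)); congr bdd; apply/funext => x; rewrite mulN1r.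
Qed.

Lemma bddB (T : Type) (f g : T -> R) :
  bdd f -> bdd g -> bdd (fun x => f x - g x).
Proof. by move=> bf bg; exact: (bddD bf (bddN bg)). Qed.

Lemma bdd_sum (T I : Type) (s : seq I) (f : I -> T -> R) :
  (forall i, bdd (f i)) -> bdd (fun x => \sum_(i <- s) f i x).
Proof.
move=> bf; elim: s => [|i s IH].
  by have := bdd_cst T 0; congr bdd; apply/funext => x; rewrite big_nil.
by have := bddD (bf i) IH; congr bdd; apply/funext => x; rewrite big_cons.
Qed.

Lemma bdd_comp (S T : Type) (h : S -> T) (f : T -> R) :
  bdd f -> bdd (fun x => f (h x)).
Proof. by move=> [C hC]; exists C => x. Qed.

(** Only the values on bounded functions are constrained, so that limits along an
ultrafilter, which are arbitrary on unbounded functions, qualify. *)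
Record is_mean (T : Type) (m : (T -> R) -> R) : Prop := IsMean {
  mean_lin : forall a f g, bdd f -> bdd g ->
    m (fun x => a * f x + g x) = a * m f + m g;
  mean_ge0 : forall f, bdd f -> (forall x, 0 <= f x) -> 0 <= m f;
  mean1 : m (fun _ => 1) = 1 }.

Section MeanTheory.
Context {T : Type} {m : (T -> R) -> R} (mm : is_mean m).

Lemma mean0 : m (fun _ => 0) = 0.
Proof.
have b0 := bdd_cst T 0; have := mean_lin mm 1 b0 b0.
rewrite (_ : (fun _ : T => _) = (fun=> 0)); last by apply/funext => x; rewrite mulr0 addr0.
lra.
Qed.

Lemma meanD f g : bdd f -> bdd g -> m (fun x => f x + g x) = m f + m g.
Proof.
move=> bf bg; rewrite -[m f]mul1r -mean_lin//; congr m.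
by apply/funext => x; rewrite mul1r.
Qed.

Lemma meanZ a f : bdd f -> m (fun x => a * f x) = a * m f.
Proof.
move=> bf; rewrite -[RHS]addr0 -mean0 -mean_lin//; last exact: bdd_cst.
by congr m; apply/funext => x; rewrite addr0.
Qed.

Lemma meanB f g : bdd f -> bdd g -> m (fun x => f x - g x) = m f - m g.
Proof.
move=> bf bg; rewrite (meanD bf (bddN bg)); congr (_ + _).
rewrite -mulN1r -meanZ//; congr m; apply/funext => x; by rewrite mulN1r.
Qed.

Lemma mean_cst a : m (fun _ => a) = a.
Proof.
rewrite -[RHS]mulr1 -(mean1 mm) -meanZ; last exact: bdd_cst.
by congr m; apply/funext => x; rewrite mulr1.
Qed.

Lemma mean_sum (I : Type) (s : seq I) (f : I -> T -> R) :
  (forall i, bdd (f i)) ->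
  m (fun x => \sum_(i <- s) f i x) = \sum_(i <- s) m (f i).
Proof.
move=> bf; elim: s => [|i s IH].
  by rewrite big_nil -[RHS]mean0; congr m; apply/funext => x; rewrite big_nil.
rewrite big_cons -IH -meanD//; last exact: bdd_sum.
by congr m; apply/funext => x; rewrite big_cons.
Qed.

Lemma mean_le f g : bdd f -> bdd g -> (forall x, f x <= g x) -> m f <= m g.
Proof.
move=> bf bg fg; rewrite -subr_ge0 -meanB// mean_ge0//; first exact: bddB.
by move=> x; rewrite subr_ge0.
Qed.

Lemma mean_norm C f : (forall x, `|f x| <= C) -> `|m f| <= C.
Proof.
move=> fC; have bf : bdd f by exists C.
have hC x : - C <= f x <= C by rewrite -ler_norml.
rewrite ler_norml -{1}[- C]mean_cst -{2}[C]mean_cst.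
by apply/andP; split; apply: mean_le => // [|x]; (exact: bdd_cst) || by case/andP: (hC x).
Qed.

Lemma exists_le_mean f eps : bdd f -> 0 < eps -> exists x, f x <= m f + eps.
Proof.
move=> bf e0; apply/not_existsP => h.
have : m f + eps <= m f.
  rewrite -[leLHS]mean_cst; apply: mean_le => // [|x]; first exact: bdd_cst.
  by rewrite leNgt; apply/negP => hx; apply: (h x); exact: ltW.
by rewrite gerDl leNgt e0.
Qed.

End MeanTheory.

Lemma mean_comp (S T : Type) (l : (S -> R) -> R) (A : S -> (T -> R) -> R) :
  is_mean l -> (forall s, is_mean (A s)) -> is_mean (fun f => l (fun s => A s f)).
Proof.
move=> hl hA.
have bA f : bdd f -> bdd (fun s => A s f).
  by move=> [C hC]; exists C => s; exact: mean_norm.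
split.
- move=> a f g bf bg; rewrite -mean_lin//; try exact: bA.
  by congr l; apply/funext => s; rewrite mean_lin.
- by move=> f bf f0; apply: (mean_ge0 hl) => [|s]; [exact: bA|exact: (mean_ge0 (hA s))].
- by rewrite -[RHS](mean1 hl); congr l; apply/funext => s; rewrite (mean1 (hA s)).
Qed.

Lemma mean_push (S T : Type) (h : S -> T) (m : (S -> R) -> R) :
  is_mean m -> is_mean (fun f => m (fun s => f (h s))).
Proof.
move=> hm; split => [a f g bf bg|f bf f0|].
- by rewrite (mean_lin hm)//; exact: bdd_comp.
- by apply: (mean_ge0 hm) => //; exact: bdd_comp.
- exact: (mean1 hm).
Qed.

Lemma mean_avg (T I : Type) (s : seq I) (h : I -> T) : (0 < size s)%N ->
  is_mean (fun f : T -> R => (size s)%:R^-1 * \sum_(i <- s) f (h i)).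
Proof.
move=> s0; have s1 : (size s)%:R != 0 :> R by rewrite pnatr_eq0 -lt0n.
split=> [a f g _ _|f _ f0|].
- rewrite big_split/= -mulr_sumr; ring.
- by apply: mulr_ge0; rewrite ?invr_ge0 ?ler0n// sumr_ge0.
- by rewrite big_const_seq count_predT iter_addr_0 mulVf.
Qed.

Definition ulim (U : set_system nat) (f : nat -> R) : R := lim (f @ U).

Lemma ulim_cvg (U : set_system nat) (f : nat -> R) :
  UltraFilter U -> bdd f -> f @ U --> ulim U f.
Proof.
move=> UU [C hC].
have fC : (f @ U) [set` `[- C, C]].
  apply: (@filterE _ U _) => x /=.
  by rewrite in_itv/= -ler_norml; exact: hC.
have [x [_ fx]] := @segment_compact R (- C) C (f @ U) _ fC.
suff: f @ U --> x by move=> fUx; apply/cvg_ex; exists x.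
(* a cluster point of an ultrafilter is a limit *)
move=> B xB; have [//|UB] := in_ultra_setVsetC (f @^-1` B) UU.
by have [y [nBy By]] := fx (~` B) B UB xB.
Qed.

Lemma ulim_mean (U : set_system nat) : UltraFilter U -> is_mean (ulim U).
Proof.
move=> UU; split.
- move=> a f g bf bg; apply: cvg_lim => //.
  by apply: cvgD; [apply: cvgMr; exact: ulim_cvg|exact: ulim_cvg].
- move=> f bf f0; apply: limr_ge; first by apply/cvg_ex; exists (ulim U f); exact: ulim_cvg.
  by apply: filterE => x; exact: f0.
- exact: lim_cst.
Qed.

Lemma ulim_cvgE (U : set_system nat) (f : nat -> R) l : UltraFilter U ->
  \oo `<=` U -> f @ \oo --> l -> ulim U f = l.
Proof.
move=> UU oU fl; apply: cvg_lim => //; apply: cvg_trans fl.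
by move=> A; exact: oU.
Qed.

End Means.

(** * Invariant means *)

Section CommutingFamily.
Context {R : realType} {T : Type}.

(** Taking the Cesaro limit along the iterates of one map makes a function
invariant under it, and commutation keeps the invariances already gained.
Composing these limits over the first k maps and letting k grow along the
ultrafilter yields invariance under the whole family. *)
Lemma commuting_family_mean (g : nat -> T -> T) (x0 : T) :
  (forall i j x, g i (g j x) = g j (g i x)) ->
  exists m : (T -> R) -> R, is_mean m /\
    forall k f, bdd f -> m (fun x => f (g k x)) = m f.
Proof.
move=> gC.
have [U [UU oU]] := @ultraFilterLemma nat \oo _.
have hU := @ulim_mean R U UU.
pose N k (f : T -> R) x := ulim U (fun n =>
  (size (iota 0 n.+1))%:R^-1 * \sum_(t <- iota 0 n.+1) f (iter t (g k) x)).
have Nmean k x : is_mean (fun f => N k f x).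
  apply: (mean_comp hU) => n.
  by apply: (@mean_avg R T nat (iota 0 n.+1) (fun t => iter t (g k) x)).
have Nbdd k f : bdd f -> bdd (N k f).
  by move=> [C hC]; exists C => x; exact: (mean_norm (Nmean k x)).
have Ncomm j k f x : N k (fun y => f (g j y)) x = N k f (g j x).
  rewrite /N; congr ulim; apply/funext => n; congr (_ * _).
  apply: eq_bigr => t _; congr f; elim: t x => [//|t IH] x.
  by rewrite !iterS gC IH.
have Ninv k f x : bdd f -> N k (fun y => f (g k y)) x = N k f x.
  move=> bf; apply/eqP; rewrite -subr_eq0; apply/eqP.
  rewrite -(@meanB _ _ _ (Nmean k x))//; last exact: bdd_comp.
  apply: ulim_cvgE => //; move: bf => [C hC].
  have hT n : (size (iota 0 n.+1))%:R^-1 *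
      (\sum_(t <- iota 0 n.+1) (f (g k (iter t (g k) x)) - f (iter t (g k) x)))
      = n.+1%:R^-1 * (f (iter n.+1 (g k) x) - f x).
    rewrite size_iota; congr (_ * _).
    have := @telescope_sumr R 0 n.+1 (fun t => f (iter t (g k) x)) isT.
    by rewrite /index_iota subn0 => <-.
  rewrite (_ : (fun n => _) = (fun n => n.+1%:R^-1 * (f (iter n.+1 (g k) x) - f x))); last first.
    by apply/funext => n; exact: hT.
  have h0 : (fun n => (C + C) * @harmonic R n) @ \oo --> 0.
    by rewrite -[X in _ --> X](mulr0 (C + C)); apply: cvgMr; exact: cvg_harmonic.
  have h0' : (fun n => - ((C + C) * @harmonic R n)) @ \oo --> 0.
    by rewrite -[X in _ --> X]oppr0; exact: cvgN.
  apply: squeeze_cvgr h0' h0; apply: nearW => n.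
  rewrite -ler_norml normrM ger0_norm ?invr_ge0 ?ler0n// mulrC.
  by apply: ler_pM => //; rewrite (le_trans (ler_normB _ _))// lerD.
pose Rk := fix Rk k : (T -> R) -> T -> R :=
  if k is k'.+1 then fun f => Rk k' (N k f) else N 0%N.
have Rmean k x : is_mean (fun f => Rk k f x).
  elim: k x => [|k IH] x /=; first exact: Nmean.
  exact: (mean_comp (IH x) (Nmean k.+1)).
have Rinv j k f x : bdd f -> (j <= k)%N -> Rk k (fun y => f (g j y)) x = Rk k f x.
  move=> bf; elim: k f bf x => [|k IH] f bf x.
    by rewrite leqn0 => /eqP ->; exact: Ninv.
  rewrite leq_eqVlt => /predU1P[->|jk] /=.
    by congr Rk; apply/funext => y; exact: Ninv.
  rewrite -(IH (N k.+1 f))//; last exact: Nbdd.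
  by congr Rk; apply/funext => y; exact: Ncomm.
exists (fun f => ulim U (fun k => Rk k f x0)); split.
  exact: (mean_comp hU (fun k => Rmean k x0)).
move=> k f bf; apply/eqP; rewrite -subr_eq0; apply/eqP.
have [C hC] := bf.
rewrite -(@meanB _ _ _ hU); last 2 first.
- by exists C => n; exact: (mean_norm (Rmean n x0)).
- by exists C => n; exact: (mean_norm (Rmean n x0)).
apply: ulim_cvgE => //; apply: cvg_near_cst; near=> n.
apply/eqP; rewrite subr_eq0; apply/eqP; apply: Rinv => //.
by near: n; exact: nbhs_infty_ge.
Unshelve. all: by end_near. Qed.
End CommutingFamily.

Section FolnerMean.
Context {R : realType} {K : fieldType}.

Lemma sum_fset_cond_bound (C : R) (f : K -> R) (G F : {fset K}) :
  (forall x, `|f x| <= C) ->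
  `|\sum_(x <- G | x \notin F) f x| <= C * (#|` G|%:R - #|` (F `&` G)%fset|%:R).
Proof.
move=> fC; apply: (le_trans (ler_norm_sum _ _ _)).
apply: (@le_trans _ _ (\sum_(x <- G | x \notin F) C)); first exact: ler_sum.
rewrite -[X in \sum_(_ <- _ | _) X]mulr1 -mulr_sumr.
suff -> : \sum_(x <- G | x \notin F) (1 : R) = #|` G|%:R - #|` (F `&` G)%fset|%:R by [].
apply/eqP; rewrite eq_sym subr_eq; apply/eqP.
rewrite (_ : \sum_(x <- G | _) 1 = (\sum_(x <- G | x \notin F) 1)%N%:R); last by rewrite natr_sum.
rewrite fsetIC -natrD; congr _%:R.
rewrite card_fset_sum1 (bigID (mem F))/= addnC; congr (_ + _)%N.
rewrite big_fset_condE -card_fset_sum1; congr (#|` _|).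
by apply/fsetP => x; rewrite !inE.
Qed.

(** Only the points of F outside F + b, and conversely, contribute to the
difference of the two sums. *)
Lemma folner_shift (C : R) (f : K -> R) (F : {fset K}) (b : K) :
  (forall x, `|f x| <= C) ->
  `|\sum_(x <- F) f (x + b) - \sum_(x <- F) f x| <=
     2 * C * (#|` F|%:R - #|` (F `&` fset_shift F b)%fset|%:R).
Proof.
move=> fC; set G := fset_shift F b.
have injb : injective (fun x : K => x + b) by move=> x y /addIr.
have cG : #|` G| = #|` F| by rewrite card_imfset.
have -> : \sum_(x <- F) f (x + b) = \sum_(x <- G) f x.
  by rewrite /G /fset_shift big_imfset//= => x y _ _ /injb.
rewrite (bigID (mem F))/= [X in _ - X](bigID (mem G))/=.
have -> : \sum_(x <- G | x \in F) f x = \sum_(x <- F | x \in G) f x.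
  rewrite big_fset_condE [RHS]big_fset_condE.
  rewrite (_ : [fset x in G | x \in F]%fset = [fset x in F | x \in G]%fset)//.
  by apply/fsetP => x; rewrite !inE andbC.
rewrite (_ : forall a c d : R, (a + c) - (a + d) = c - d); last by move=> a c d; ring.
apply: (le_trans (ler_normB _ _)).
have h1 := sum_fset_cond_bound G F fC.
have h2 := sum_fset_cond_bound F G fC.
by rewrite cG in h1; rewrite fsetIC in h2; lra.
Qed.

Lemma frequently_of_limsup (u : nat -> \bar R) : (0 < limn_esup u)%E ->
  exists e : R, 0 < e /\ forall A, \oo A -> exists n, A n /\ (e%:E < u n)%E.
Proof.
move=> u0; have [e [e0 eu]] : exists e : R, 0 < e /\ (e%:E < limn_esup u)%E.
  case: (limn_esup u) u0 => [r|_|]; last by rewrite ltNge leNye.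
    by rewrite lte_fin => r0; exists (r / 2); rewrite lte_fin; split; lra.
  by exists 1; rewrite ltry.
exists e; split=> // A oA.
have /ereal_sup_gt[_ [n An <-] eun] : (e%:E < ereal_sup (u @` A))%E.
  by apply: (lt_le_trans eu); apply: ereal_inf_lbound; exists A.
by exists n.
Qed.

(** The ultrafilter is chosen to contain a set of indices, cofinal in nat, where
the density of E stays above a positive constant. *)
Lemma folner_mean (F : nat -> {fset K}) (E : set K) : folner R F ->
  (0 < limn_esup (fun n => (fset_ratio R [fset x in F n | x \in E]%fset (F n))%:E))%E ->
  exists L : (K -> R) -> R, [/\ is_mean L,
    forall b f, bdd f -> L (fun x => f (x + b)) = L f &
    0 < L (fun x => (x \in E)%:R)].
Proof.
move=> [F0 Finv] /frequently_of_limsup[e [e0 He]].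
pose r n : R := fset_ratio R [fset x in F n | x \in E]%fset (F n).
pose D := [set n | e < r n].
have WP : ProperFilter (within D \oo).
  apply: Build_ProperFilter => h.
  have [n [Dn]] := He _ h; rewrite lte_fin => ern; exact: Dn.
have [U [UU WU]] := @ultraFilterLemma nat _ WP.
have oU : \oo `<=` U by move=> A oA; apply: WU; apply: filterS oA.
have UD : U D by apply: WU; rewrite /within/=; apply: (@filterE _ \oo).
have hU := @ulim_mean R U UU.
pose A n (f : K -> R) := (size (F n))%:R^-1 * \sum_(x <- F n) f x.
have F0' n : (0 < size (F n))%N by rewrite lt0n cardfs_eq0.
have F0R n : 0 < (size (F n))%:R :> R by rewrite ltr0n.
have Amean n : is_mean (A n) by exact: (@mean_avg R K K (F n) id (F0' n)).
have Abdd f : bdd f -> bdd (fun n => A n f).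
  by move=> [C hC]; exists C => n; exact: mean_norm.
exists (fun f => ulim U (fun n => A n f)); split.
- exact: mean_comp.
- move=> b f bf; apply/eqP; rewrite -subr_eq0; apply/eqP.
  rewrite -(meanB hU); last 2 first.
  + by apply: (Abdd (fun x => f (x + b))); exact: (bdd_comp (fun x => x + b)).
  + exact: Abdd.
  move: bf => [C fC]; apply: ulim_cvgE => //.
  have hb : (fun n => 2 * C * (1 - fset_ratio R (F n `&` fset_shift (F n) b)%fset (F n))) @ \oo --> 0.
    rewrite -[X in _ --> X](mulr0 (2 * C)); apply: cvgMr.
    by rewrite -[X in _ --> X](subrr 1); apply: cvgB; [exact: cvg_cst|exact: Finv].
  have hb' : (fun n => - (2 * C * (1 - fset_ratio R (F n `&` fset_shift (F n) b)%fset (F n)))) @ \oo --> 0.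
    by rewrite -[X in _ --> X]oppr0; exact: cvgN.
  apply: squeeze_cvgr hb' hb; apply: nearW => n.
  rewrite -ler_norml /A -mulrBr normrM ger0_norm ?invr_ge0 ?ler0n//.
  rewrite ler_pdivrMl//; apply: le_trans (folner_shift (F n) b fC) _.
  rewrite /fset_ratio le_eqVlt; apply/orP; left; apply/eqP.
  by field; rewrite gt_eqF.
- apply: (@lt_le_trans _ _ e) => //.
  apply: limr_ge.
    apply/cvg_ex; exists (ulim U (fun n => A n (fun x => (x \in E)%:R))).
    apply: ulim_cvg; apply: Abdd; exists 1 => x.
    by rewrite ger0_norm ?ler0n// lern1 leq_b1.
  apply: filterS UD => n; rewrite /D/= => /ltW; congr (_ <= _).
  rewrite /r /fset_ratio /A mulrC; congr (_ * _).
  rewrite card_fset_sum1 -big_fset_condE natr_sum big_mkcond/=.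
  by apply: eq_bigr => x _; case: ifP.
Qed.

End FolnerMean.

(** * Positive definite functions *)

Section PositiveDefinite.
Context {R : realType}.

Definition gram (G : zmodType) (phi : G -> R) (s : seq (R * G)) : R :=
  \sum_(p <- s) \sum_(q <- s) p.1 * q.1 * phi (p.2 - q.2).

Definition posdef (G : zmodType) (phi : G -> R) : Prop :=
  (forall y, phi (- y) = phi y) /\ forall s, 0 <= gram phi s.

(** The square of the norm of t v_0 minus the sum of the v_x, where phi (x - y) is
read as <v_x, v_y>. *)
Lemma posdef_test (G : zmodType) (phi : G -> R) (t : R) (s : seq G) :
  posdef phi ->
  0 <= t ^+ 2 * phi 0 - 2 * t * (\sum_(x <- s) phi x)
       + \sum_(x <- s) \sum_(y <- s) phi (x - y).
Proof.
move=> [phiN phi_ge0].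
have := phi_ge0 ((t, 0) :: [seq (-1, x) | x <- s]).
set rhs := (X in _ -> 0 <= X).
rewrite /gram big_cons/= big_cons/= !big_map/= subr0.
under eq_bigr do rewrite sub0r phiN.
rewrite -mulr_sumr.
under [X in _ + _ + X]eq_bigr do rewrite big_cons/= subr0 big_map/=.
rewrite big_split/= -mulr_sumr.
under [X in _ + _ + (_ + X)]eq_bigr => i _ do
  (under eq_bigr do rewrite mulrNN !mul1r).
by move=> h; apply: (le_trans h); rewrite le_eqVlt; apply/orP; left; apply/eqP; rewrite /rhs; ring.
Qed.

Lemma posdef_le0 (G : zmodType) (phi : G -> R) y : posdef phi -> `|phi y| <= phi 0.
Proof.
move=> pd.
have := posdef_test 1 [:: y] pd; have := posdef_test (-1) [:: y] pd.
rewrite !big_seq1 subrr ler_norml => h1 h2; apply/andP; split; lra.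
Qed.

Lemma posdef0_ge0 (G : zmodType) (phi : G -> R) : posdef phi -> 0 <= phi 0.
Proof. by move=> pd; apply: le_trans (posdef_le0 0 pd). Qed.

Lemma posdef_bdd (G : zmodType) (T : Type) (phi : G -> R) (h : T -> G) :
  posdef phi -> bdd (fun x => phi (h x)).
Proof. by move=> pd; exists (phi 0) => x; exact: posdef_le0. Qed.

Lemma posdef_pull (G H : zmodType) (h : G -> H) (phi : H -> R) :
  (forall x y, h (x - y) = h x - h y) -> posdef phi -> posdef (fun x => phi (h x)).
Proof.
move=> hB [phiN phi_ge0]; split=> [y|s].
  have h0 : h 0 = 0 by rewrite -(subrr 0) hB subrr.
  by rewrite -sub0r hB h0 sub0r phiN.
rewrite /gram; have := phi_ge0 [seq (p.1, h p.2) | p <- s].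
rewrite /gram big_map; under eq_bigr do rewrite big_map/=.
by under [X in _ -> 0 <= X]eq_bigr => p _ do (under eq_bigr do rewrite hB).
Qed.

Lemma posdef_mean (G : zmodType) (T : Type) (m : (T -> R) -> R)
    (phi : T -> G -> R) : is_mean m -> (forall t, posdef (phi t)) ->
  (forall y, bdd (fun t => phi t y)) -> posdef (fun y => m (fun t => phi t y)).
Proof.
move=> hm pd bphi; split=> [y|s].
  by congr m; apply/funext => t; case: (pd t).
rewrite /gram; under eq_bigr => p _ do under eq_bigr => q _ do rewrite -(meanZ hm)//.
under eq_bigr => p _.
  rewrite -(mean_sum hm); last by move=> i; exact: bddZ.
  over.
rewrite -(mean_sum hm); last by move=> i; apply: bdd_sum => j; exact: bddZ.
apply: (mean_ge0 hm) => [|t]; last by case: (pd t) => _ /(_ s).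
by apply: bdd_sum => i; apply: bdd_sum => j; exact: bddZ.
Qed.

Lemma quadratic_growth (a b : R) : (forall n : nat, 0 <= a * n%:R ^+ 2 + b * n%:R) -> 0 <= a.
Proof.
move=> h; rewrite leNgt; apply/negP => a0.
have na0 : 0 < - a by lra.
have := @archi_boundP R (`|b| / - a); rewrite divr_ge0// ?ltW// => /(_ isT).
set n := Num.Def.archi_bound _ => hn.
rewrite ltr_pdivrMr// in hn.
have n0 : 0 < n%:R :> R.
  rewrite lt0r ler0n andbT; apply/eqP => n0.
  by move: hn; rewrite n0 mul0r ltNge normr_ge0.
have := h n; rewrite expr2 mulrA -mulrDl pmulr_lge0//.
have := ler_norm b; lra.
Qed.

(** Bessel's inequality, with phi (x - y) = <v_x, v_y> and v = v_0.  The vectors v_x,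
x in s, have average inner product c with v and are orthogonal in the sense that
the square of the norm of their sum is n phi 0; so c is of order 1 / sqrt n. *)
Lemma orthogonal_family (G : zmodType) (phi : G -> R) (c : R) :
  posdef phi ->
  (forall n, exists s : seq G, [/\ size s = n, \sum_(x <- s) phi x = n%:R * c &
     \sum_(x <- s) \sum_(y <- s) phi (x - y) = n%:R * phi 0]) -> c = 0.
Proof.
move=> pd h.
have : 0 <= - (2 * c ^+ 2).
  apply: (@quadratic_growth _ ((c ^+ 2 + 1) * phi 0)) => -[|N].
    by rewrite !mulr0n expr0n !mulr0 addr0.
  have [s [_ hs1 hs2]] := h (N.+1 ^ 2)%N.
  have := posdef_test (N.+1%:R * c) s pd; rewrite hs1 hs2 natrX.
  have N0 : 0 < N.+1%:R :> R by rewrite ltr0n.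
  rewrite -(pmulr_rge0 _ N0); set x := (X in 0 <= X) => hx.
  rewrite -(pmulr_rge0 _ N0) -(pmulr_rge0 _ N0).
  by move: hx; rewrite /x; congr (_ <= _); ring.
rewrite oppr_ge0 pmulr_rle0// => /(conj (sqr_ge0 c))/andP.
by rewrite -eq_le eq_sym sqrf_eq0 => /eqP.
Qed.

(** If P is the projection onto the invariant vectors, then m phi = <P v, v> and
the claim reads |(t - P) v|^2 >= 0.  No projection has to be built: P v is
approximated by the average of N translates of v, chosen one after the other so
that each adds to the norm at most its mean contribution, up to an error 1. *)
Lemma invariant_mean_quadratic (G : zmodType) (phi : G -> R) (m : (G -> R) -> R) (t : R) :
  posdef phi -> is_mean m ->
  (forall b f, bdd f -> m (fun x => f (x + b)) = m f) ->
  0 <= t ^+ 2 * phi 0 - 2 * t * m phi + m phi.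
Proof.
move=> pd hm minv; set L := m phi.
have bphi : bdd phi by exact: (posdef_bdd id).
have H (N r : nat) : exists s : seq G, size s = r /\
    \sum_(x <- s) \sum_(y <- s) phi (x - y) - 2 * t * N%:R * \sum_(x <- s) phi x
    <= r%:R * (phi 0 + 1 - 2 * t * N%:R * L) + (r%:R ^+ 2 - r%:R) * L.
  elim: r => [|r [s [<- IH]]].
    by exists [::]; rewrite !big_nil/=; split=> //; lra.
  (* adding the point u changes the left-hand side by phi 0 + psi u *)
  pose psi x := 2 * (\sum_(y <- s) phi (x - y)) - 2 * t * N%:R * phi x.
  have bs : bdd (fun x => \sum_(y <- s) phi (x - y)).
    by apply: bdd_sum => y; exact: posdef_bdd.
  have bpsi : bdd psi by apply: bddB; exact: bddZ.
  have [u] := exists_le_mean hm bpsi ltr01.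
  have -> : m psi = 2 * ((size s)%:R * L) - 2 * t * N%:R * L.
    rewrite (meanB hm); [|exact: bddZ..].
    rewrite !(meanZ hm)// (mean_sum hm); last by move=> y; exact: posdef_bdd.
    congr (_ * _ - _).
    under eq_bigr => y _ do rewrite (minv (- y) phi bphi).
    by rewrite big_const_seq count_predT iter_addr_0 mulr_natl.
  rewrite /psi => hu; exists (u :: s); split=> //.
  rewrite !big_cons subrr /=.
  under [X in _ + X - _]eq_bigr do rewrite big_cons.
  rewrite big_split/=.
  have -> : \sum_(i <- s) phi (i - u) = \sum_(y <- s) phi (u - y).
    by apply: eq_bigr => y _; rewrite -opprB; case: pd.
  rewrite -(natr1 (size s)); nra.
apply: (@quadratic_growth _ (phi 0 + 1 - L)) => N.
have [s [ss hs]] := H N N.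
have := posdef_test (t * N%:R) s pd; nra.
Qed.

End PositiveDefinite.

(** * Averaging along an axis *)

Section FieldMeans.
Context {R : realType} {K : fieldType}.

(** A mean on the multiplicative group, carried by K so that it can be combined with
additive means; the last property records that 0 has no weight. *)
Lemma multiplicative_mean : ([set: K] #= [set: nat])%card ->
  exists m : (K -> R) -> R, [/\ is_mean m,
    forall c f, c != 0 -> bdd f -> m (fun x => f (c * x)) = m f &
    forall f g, (forall x, x != 0 -> f x = g x) -> m f = m g].
Proof.
move=> /card_set_bijP[code [_ code_inj _]].
pose h n := xget 1 [set x | code x = n].
have hcode c : h (code c) = c.
  have /= := @xgetPex _ 1 [set x | code x = code c] (ex_intro _ c erefl).
  by apply: code_inj; rewrite in_setT.
pose T := {x : K | x != 0}.
pose one : T := exist _ 1 (oner_neq0 K).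
pose g0 n : T := insubd one (h n).
have gx (x y : T) : val x * val y != 0 by exact: (mulf_neq0 (valP x) (valP y)).
pose g n (x : T) : T := exist _ (val (g0 n) * val x) (gx (g0 n) x).
have [|m [hm minv]] := @commuting_family_mean R T g one.
  by move=> i j x; apply: val_inj => /=; rewrite mulrCA.
exists (fun f => m (fun x => f (val x))); split.
- exact: mean_push.
- move=> c f c0 bf; have hn := hcode c.
  rewrite -(minv (code c) (fun x : T => f (val x))); last exact: bdd_comp.
  congr m; apply/funext => x /=; congr (f (_ * _)).
  by rewrite /g0 insubdK ?hn.
- by move=> f g' fg; congr m; apply/funext => x; exact: (fg _ (valP x)).
Qed.

(** The multiplicative average of the dilates of a translation invariant mean stays
translation invariant, because dilations normalize translations. *)
Lemma affine_mean (L : (K -> R) -> R) : ([set: K] #= [set: nat])%card ->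
  is_mean L -> (forall b f, bdd f -> L (fun x => f (x + b)) = L f) ->
  exists m : (K -> R) -> R, [/\ is_mean m,
    forall b f, bdd f -> m (fun x => f (x + b)) = m f &
    forall c f, c != 0 -> bdd f -> m (fun x => f (c * x)) = m f].
Proof.
move=> cK hL Linv; have [mu [hmu muinv mueq]] := multiplicative_mean cK.
exists (fun f => mu (fun b => L (fun u => f (b * u)))); split.
- by apply: (mean_comp hmu) => b; exact: (@mean_push _ _ _ (fun u => b * u)).
- move=> b f bf; apply: mueq => c c0.
  rewrite -[RHS](Linv (c^-1 * b)); last exact: (bdd_comp (fun u => c * u)).
  by congr L; apply/funext => u; rewrite mulrDr mulVKf.
- move=> c f c0 bf; rewrite -[RHS](muinv c)//.
    by congr mu; apply/funext => b; congr L; apply/funext => u; rewrite mulrA.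
  have [C hC] := bf; exists C => b.
  apply: (mean_norm hL) => x; exact: hC.
Qed.

Section Split.
Context {V : zmodType} (m : (K -> R) -> R) (hm : is_mean m).
Hypothesis mshift : forall b f, bdd f -> m (fun x => f (x + b)) = m f.
Hypothesis mscale : forall c f, c != 0 -> bdd f -> m (fun x => f (c * x)) = m f.
Context (e : K -> V) (eB : forall x y, e (x - y) = e x - e y).
Context (phi : V -> R) (pd : posdef phi).

(** The function y |-> <U_y P v, P v>, where phi (y) = <U_y v, v> and P projects
onto the vectors fixed by the image of e. *)
Definition avg_along (y : V) : R := m (fun u => phi (y + e u)).

(** The Gram form of phi at s, translated along e, is itself a positive definite
function on K; its mean is the Gram form of the average. *)
Lemma avg_along_test (s : seq (R * V)) (t : R) :
  0 <= t ^+ 2 * gram phi s - 2 * t * gram avg_along s + gram avg_along s.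
Proof.
have e0 : e 0 = 0 by rewrite -[in LHS](subrr 0) eB subrr.
have eN x : e (- x) = - e x by rewrite -[in LHS]sub0r eB e0 sub0r.
pose g u := \sum_(a <- s) \sum_(b <- s) a.1 * b.1 * phi (a.2 - b.2 + e u).
have gpd : posdef g.
  split=> [u|s'].
    rewrite /g exchange_big/=; apply: eq_bigr => a _; apply: eq_bigr => b _.
    rewrite [b.1 * _]mulrC eN (_ : b.2 - a.2 - e u = - (a.2 - b.2 + e u)).
      by case: pd => ->.
    by rewrite opprD opprB.
  have [_ /(_ [seq (d.1 * a.1, a.2 + e d.2) | d <- s', a <- s])] := pd.
  rewrite /gram big_allpairs_dep/=.
  under eq_bigr => d _ do under eq_bigr => a _ do rewrite big_allpairs_dep/=.
  under eq_bigr => d _ do rewrite exchange_big/=.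
  move=> H; apply: (le_trans H); rewrite le_eqVlt; apply/orP; left; apply/eqP.
  apply: eq_bigr => d _; apply: eq_bigr => d' _; rewrite /g mulr_sumr.
  apply: eq_bigr => a _; rewrite mulr_sumr; apply: eq_bigr => b _.
  by rewrite eB opprD addrACA mulrACA !mulrA.
have g0 : g 0 = gram phi s.
  by apply: eq_bigr => a _; apply: eq_bigr => b _; rewrite e0 addr0.
have mg : m g = gram avg_along s.
  have bt (a b : R * V) : bdd (fun u => a.1 * b.1 * phi (a.2 - b.2 + e u)).
    by apply: bddZ; exact: (posdef_bdd (fun u => a.2 - b.2 + e u)).
  rewrite /g (mean_sum hm); last by move=> a; exact: bdd_sum.
  apply: eq_bigr => a _; rewrite (mean_sum hm)//; apply: eq_bigr => b _.
  by rewrite (meanZ hm)//; exact: (posdef_bdd (fun u => a.2 - b.2 + e u)).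
by have := invariant_mean_quadratic t gpd hm mshift; rewrite g0 mg.
Qed.

Lemma avg_alongN y : avg_along (- y) = avg_along y.
Proof.
have e0 : e 0 = 0 by rewrite -[in LHS](subrr 0) eB subrr.
rewrite /avg_along -(mscale (c := -1)); last 2 first.
- by rewrite oppr_eq0 oner_eq0.
- exact: (posdef_bdd (fun u => - y + e u)).
congr m; apply/funext => u; rewrite mulN1r -[- u]sub0r eB e0 sub0r -opprD.
by case: pd.
Qed.

Lemma avg_along_posdef : posdef avg_along.
Proof.
split=> [y|s]; first exact: avg_alongN.
by have := avg_along_test s 0; rewrite expr0n mulr0 !mul0r subr0 add0r.
Qed.

Lemma sub_avg_along_posdef : posdef (fun y => phi y - avg_along y).
Proof.
split=> [y|s]; first by rewrite avg_alongN; case: pd => ->.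
have := avg_along_test s 1; rewrite expr1n mul1r mulr1.
rewrite /gram; under [X in _ -> 0 <= X]eq_bigr => a _.
  under eq_bigr => b _ do rewrite mulrBr.
  rewrite sumrB; over.
by rewrite sumrB; lra.
Qed.

Lemma avg_along_shift y u : avg_along (y + e u) = avg_along y.
Proof.
rewrite /avg_along -(mshift (- u)); last exact: (posdef_bdd (fun v => y + e u + e v)).
by congr m; apply/funext => v; rewrite -addrA [e u + _]addrC eB subrK.
Qed.

End Split.
End FieldMeans.

(** * Generic orthogonality and null sets *)

Section Generic.
Context {R : realType} {K : fieldType}.
Hypothesis cK : ([set: K] #= [set: nat])%card.

Lemma uniq_seq_of_size n : exists s : seq K, uniq s /\ size s = n.
Proof.
move: cK => /card_set_bijP[code [_ _ code_surj]].
have [h hK] : exists h : nat -> K, forall n, code (h n) = n.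
  have /choice[h hP] : forall n, exists c, code c = n.
    by move=> k; have [c _ ck] := code_surj k I; exists c.
  by exists h.
exists (map h (iota 0 n)); rewrite size_map size_iota map_inj_uniq ?iota_uniq//.
exact: can_inj hK.
Qed.

Lemma exists_nonroot (P : {poly K}) : P != 0 -> exists x, P.[x] != 0.
Proof.
move=> P0; have [s [us ss]] := uniq_seq_of_size (size P).
apply/not_existsP => h.
have := max_poly_roots P0 _ us; rewrite ss ltnn => /(_ _)/negP; apply => //.
apply/allP => x _; rewrite rootE; apply/negPn/negP; exact: h.
Qed.

(** Bessel's inequality for a family of which two members are orthogonal as soon
as a nonzero polynomial, depending on the first one, does not vanish at the
second: since K is infinite, arbitrarily long pairwise orthogonal subfamilies can
be picked greedily. *)
Lemma generic_orthogonality (G : zmodType) (C : G -> R) (c : R) (y : K -> G) : posdef C ->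
  (forall e, e != 0 -> C (y e) = c) ->
  (forall e', e' != 0 -> exists P : {poly K}, P != 0 /\
     forall e, e != 0 -> P.[e] != 0 -> C (y e - y e') = 0) -> c = 0.
Proof.
move=> pd yc yP; apply: (orthogonal_family pd) => n.
have /choice[t tP] : forall e', exists P : {poly K}, e' != 0 -> P != 0 /\
    forall e, e != 0 -> P.[e] != 0 -> C (y e - y e') = 0.
  move=> e'; have [->|/yP[P PP]] := eqVneq e' 0; first by exists 0.
  by exists P.
suff [s [ss s0 s1 s2]] : exists s : seq K, [/\ size s = n, all (fun e => e != 0) s,
    \sum_(x <- s) C (y x) = n%:R * c &
    \sum_(x <- s) \sum_(z <- s) C (y x - y z) = n%:R * C 0].
  exists (map y s); rewrite size_map !big_map; split=> //.
  by under eq_bigr do rewrite big_map.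
elim: n => [|n [s [ss s0 s1 s2]]].
  by exists [::]; rewrite !big_nil !mul0r.
have [e] : exists e, ('X * \prod_(e' <- s) t e').[e] != 0.
  apply: exists_nonroot; rewrite mulf_neq0 ?polyX_eq0//.
  elim: s s0 {ss s1 s2} => [|e' s IH] /=; first by rewrite big_nil oner_neq0.
  by move=> /andP[e'0 /IH]; rewrite big_cons; apply: mulf_neq0; case: (tP _ e'0).
rewrite hornerM hornerX mulf_eq0 negb_or horner_prod => /andP[e0 eP].
have ort e' : e' \in s -> C (y e - y e') = 0.
  move=> e's; have [_] := tP _ (allP s0 _ e's); apply=> //.
  by apply: contraNneq eP => te; rewrite (big_rem e')//= te mul0r.
exists (e :: s); split; rewrite /= ?ss ?e0//.
  by rewrite big_cons s1 yc// -(natr1 n) mulrDl mul1r addrC.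
rewrite !big_cons subrr -(natr1 n) mulrDl mul1r -s2.
rewrite [X in C 0 + X]big_seq big1 ?addr0; last by move=> i; exact: ort.
rewrite addrC; congr (_ + _); apply: eq_big_seq => x xs.
rewrite big_cons -opprB; case: pd => -> _; by rewrite ort// add0r.
Qed.

Lemma exprz_neq_poly (e' : K) (n : int) : e' != 0 -> n != 0 ->
  exists P : {poly K}, P != 0 /\ forall e, e != 0 -> P.[e] != 0 -> e ^ n != e' ^ n.
Proof.
move=> e'0 n0; exists ('X^`|n|%N - (e' ^+ `|n|%N)%:P); split.
  by rewrite -size_poly_eq0 size_XnsubC// absz_gt0.
move=> e e0; rewrite hornerD hornerXn hornerN hornerC subr_eq0.
apply: contra => /eqP; case: n n0 => k _; first by move=> h; apply/eqP; exact: h.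
by rewrite !NegzE -!exprnN => /invr_inj h; apply/eqP; exact: h.
Qed.

Context {m : (K -> R) -> R} (hm : is_mean m).
Hypothesis mshift : forall b f, bdd f -> m (fun x => f (x + b)) = m f.
Hypothesis mscale : forall c f, c != 0 -> bdd f -> m (fun x => f (c * x)) = m f.

(** A point has infinitely many disjoint translates. *)
Lemma mean_point (r : K) : m (fun x => (x == r)%:R) = 0.
Proof.
have b1 (t : K) : bdd (fun x : K => (x == t)%:R : R).
  by exists 1 => x; rewrite ger0_norm ?ler0n// lern1 leq_b1.
have c0 : 0 <= m (fun x => (x == r)%:R) by apply: (mean_ge0 hm) => // x; rewrite ler0n.
apply/eqP; rewrite eq_le c0 andbT.
rewrite -oppr_ge0; apply: (@quadratic_growth _ _ 1) => n.
have [s [us ss]] := uniq_seq_of_size n.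
have : m (fun x => \sum_(t <- s) (x == t)%:R) <= 1.
  rewrite -[leRHS](mean_cst hm); apply: (mean_le hm) => [||x].
  - exact: bdd_sum.
  - exact: bdd_cst.
  - rewrite -natr_sum lern1.
    suff -> : \sum_(t <- s) (x == t : nat) = count_mem x s.
      by rewrite count_uniq_mem// leq_b1.
    rewrite -sum1_count [RHS]big_mkcond/=; apply: eq_bigr => t _.
    by rewrite eq_sym; case: eqP.
rewrite (mean_sum hm)//.
under eq_bigr => t _.
  rewrite -(mshift (t - r))//.
  rewrite (_ : (fun x => _) = (fun x : K => (x == r)%:R : R)); first over.
  by apply/funext => x; rewrite -[in RHS](inj_eq (addIr (t - r))) [r + _]addrC subrK.
rewrite big_const_seq count_predT iter_addr_0 ss -mulr_natl => hn.
have n0 : 0 <= n%:R :> R by rewrite ler0n.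
nra.
Qed.

(** The finitely many roots of P are removed one at a time. *)
Lemma mean_off_roots (P : {poly K}) (f g : K -> R) : P != 0 -> bdd f -> bdd g ->
  (forall x, P.[x] != 0 -> f x = g x) -> m f = m g.
Proof.
have [n] := ubnP (size P); elim: n P f => // n IH P f sP P0 bf bg fg.
have [noroot|/existsNP[r Pr]] := pselect (forall x, P.[x] != 0).
  by congr m; apply/funext => x; exact: fg.
have /factor_theorem[Q PQ] : root P r by rewrite rootE; apply/negPn/negP.
have Q0 : Q != 0 by apply: contraNneq P0 => Q0; rewrite PQ Q0 mul0r.
pose f' x := f x + (g r - f r) * (x == r)%:R.
have b1 : bdd (fun x : K => (x == r)%:R : R).
  by exists 1 => x; rewrite ger0_norm ?ler0n// lern1 leq_b1.
have -> : m f = m f'.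
  by rewrite (meanD hm)// ?(meanZ hm)// ?mean_point ?mulr0 ?addr0//; exact: bddZ.
apply: (IH Q) => //.
- by move: sP; rewrite PQ size_Mmonic ?monicXsubC// size_XsubC addn2/= ltnS.
- by apply: bddD => //; exact: bddZ.
move=> x Qx; rewrite /f'; have [->|xr] := eqVneq x r.
  by rewrite mulr1 addrC subrK.
rewrite mulr0 addr0; apply: fg.
by rewrite PQ hornerM mulf_neq0// hornerXsubC subr_eq0.
Qed.
End Generic.

(** * Vanishing at mixing weights *)

Section Torus.
Context {R : realType} {K : fieldType} {I : finType}.
Hypothesis cK : ([set: K] #= [set: nat])%card.
Context {m : (K -> R) -> R} (hm : is_mean m).
Hypothesis mshift : forall b f, bdd f -> m (fun x => f (x + b)) = m f.
Hypothesis mscale : forall c f, c != 0 -> bdd f -> m (fun x => f (c * x)) = m f.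

Local Notation V := {ffun I -> K}.

Definition torus (w : I -> int) (b : K) (y : V) : V := [ffun i => b ^ w i * y i].
Definition axis (i : I) (u : K) : V := [ffun k => if k == i then u else 0].
Definition torus_curve w (l eps : K) (y : K -> V) : K -> V :=
  fun h => torus w l (y (eps * h)).

Definition poly_curve (D : nat) (a : I -> nat -> K) : K -> V :=
  fun h => [ffun i => \sum_(j < D) a i j * h ^+ j].

(** Below, phi depends on the coordinates in S only, i0 carries a weight of maximal
absolute value, and phi has mean zero along the axis i0. *)
Section Fixed.
Context {w : I -> int} {S : {set I}} {i0 : I} {phi : V -> R}.
Hypothesis pd : posdef phi.
Hypothesis phi_torus : forall b y, b != 0 -> phi (torus w b y) = phi y.
Hypothesis phi_S : forall y y' : V, {in S, y =1 y'} -> phi y = phi y'.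
Hypothesis i0S : i0 \in S.
Hypothesis wmax : forall i, i \in S -> (`|w i| <= `|w i0|)%N.
Hypothesis wK : forall i, i \in S -> (w i)%:~R != 0 :> K.
Hypothesis w_inj : {in S &, injective w}.
Hypothesis mix : m (fun u => phi (axis i0 u)) = 0.

Definition curve_mean (y : K -> V) : R := m (fun h => phi (y h)).

(** The group here is that of all curves with pointwise addition, so that Bessel's
inequality can be used for families of curves. *)
Lemma curve_mean_posdef : posdef (curve_mean : (K -> V : zmodType) -> R).
Proof.
apply: (posdef_mean (phi := fun h (y : K -> V) => phi (y h)) hm) => [h|y].
  exact: (@posdef_pull _ (K -> V : zmodType) V (fun y => y h) phi).
exact: posdef_bdd.
Qed.

Lemma curve_mean_torus l eps y : l != 0 -> eps != 0 ->
  curve_mean (torus_curve w l eps y) = curve_mean y.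
Proof.
move=> l0 e0; rewrite /curve_mean /torus_curve -[RHS](mscale (c := eps))//.
  by congr m; apply/funext => h; rewrite phi_torus.
exact: posdef_bdd.
Qed.

(** The one-parameter subgroup, indexed by e, of the torus acting on curves that
fixes the monomial h ^ j of weight k. *)
Definition slope_curve (k : int) (j : nat) (y : K -> V) (e : K) :=
  torus_curve w (e ^+ j) (e ^ (- k)) y.

Lemma curve_mean_slope k j y e : e != 0 -> curve_mean (slope_curve k j y e) = curve_mean y.
Proof. by move=> e0; apply: curve_mean_torus; rewrite ?expf_neq0 ?expfz_neq0. Qed.

Lemma slope_coef (k : int) (j : nat) (e : K) (k1 : int) (j1 : nat) : e != 0 ->
  (e ^+ j) ^ k1 * (e ^ (- k)) ^+ j1 = e ^ (j%:Z * k1 - k * j1%:Z).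
Proof.
by move=> e0; rewrite !exprnP !exprz_exp -expfzDr// mulNr.
Qed.

Lemma slope_curve_sub (y : K -> V) D a k j e e' i h : e != 0 -> e' != 0 ->
  (forall h, y h i = \sum_(j < D) a i j * h ^+ j) ->
  (slope_curve k j y e - slope_curve k j y e' : K -> V) h i =
  \sum_(j1 < D) ((e ^ (j%:Z * w i - k * j1%:Z) - e' ^ (j%:Z * w i - k * j1%:Z)) * a i j1) * h ^+ j1.
Proof.
move=> e0 e'0 yi; rewrite /slope_curve /torus_curve !ffunE !yi !mulr_sumr -sumrB.
apply: eq_bigr => j1 _; rewrite -!slope_coef// !exprMn; ring.
Qed.

Lemma w_neq0 i : i \in S -> w i != 0.
Proof. by move=> /wK; apply: contraNneq => ->. Qed.

(** Induction on the number of monomials whose slope j / w i differs from that of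
the linear monomial of weight w i0.  Such a monomial is fixed by its one-parameter
subgroup, hence absent from the difference of two transforms, while the linear
monomial is multiplied by different powers of e and survives.  When none is left,
the maximality of |w i0| leaves only the linear monomial itself. *)
Lemma poly_curve_mean D a : (1 < D)%N -> a i0 1%N != 0 -> curve_mean (poly_curve D a) = 0.
Proof.
move=> D1.
pose bad (a : I -> nat -> K) : {set I * 'I_D} := ([set ij : I * 'I_D |
  [&& ij.1 \in S, a ij.1 ij.2 != 0 & w ij.1 != w i0 * (ij.2 : nat)%:Z]])%SET.
have [n] := ubnP #|bad a|; elim: n a => // n IH a; rewrite ltnS => bn a1.
have [b0|[[i j]]] := set_0Vmem (bad a).
  have E h : phi (poly_curve D a h) = phi (axis i0 (a i0 1%N * h)).
    have aS i j : i \in S -> a i j != 0 -> (j < D)%N -> (i == i0) && (j == 1%N).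
      move=> iS aij jD; have : (i, Ordinal jD) \notin bad a by rewrite b0 inE.
      rewrite inE/= iS aij/= => /negPn/eqP wij.
      have := wmax iS; rewrite wij abszM absz_nat.
      have wi := w_neq0 iS; have w0 := w_neq0 i0S.
      rewrite -[leqRHS]muln1 leq_pmul2l ?absz_gt0// => j1.
      have ej1 : j = 1%N.
        by case: j {jD aij} wij j1 => [|[|]]// wi0; rewrite wi0 mulr0 eqxx in wi.
      rewrite ej1 eqxx andbT; apply/eqP; apply: w_inj => //.
      by rewrite wij ej1 mulr1.
    apply: phi_S => i iS; rewrite !ffunE; have [->|ii0] := eqVneq i i0.
      rewrite (bigD1 (Ordinal D1))//= expr1 big1 ?addr0// => j jn.
      have [->|/(aS _ _ i0S)/(_ (ltn_ord j))] := eqVneq (a i0 j) 0; first by rewrite mul0r.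
      by rewrite eqxx/= => j1; move: jn; rewrite -val_eqE/= j1.
    rewrite big1// => j _.
    have [->|/(aS _ _ iS)/(_ (ltn_ord j))] := eqVneq (a i j) 0; first by rewrite mul0r.
    by rewrite (negbTE ii0).
  rewrite /curve_mean (_ : (fun h => _) = (fun h => phi (axis i0 (a i0 1%N * h)))).
    by rewrite (mscale (f := fun u => phi (axis i0 u)))//; exact: posdef_bdd.
  exact/funext.
rewrite inE/= => /and3P[iS aij wij].
apply: (generic_orthogonality cK (y := slope_curve (w i) j (poly_curve D a)) curve_mean_posdef).
  by move=> e e0; exact: curve_mean_slope.
move=> e' e'0.
(* the exponent with which e acts on the linear monomial *)
have nz : j%:Z * w i0 - w i * 1%N%:Z != 0 by rewrite mulr1 subr_eq0 eq_sym mulrC.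
have [P [P0 Pe]] := exprz_neq_poly e'0 nz.
exists P; split=> // e e0 /(Pe _ e0) ee'.
pose a' i1 j1 := (e ^ (j%:Z * w i1 - w i * j1%:Z) - e' ^ (j%:Z * w i1 - w i * j1%:Z)) * a i1 j1.
have -> : slope_curve (w i) j (poly_curve D a) e - slope_curve (w i) j (poly_curve D a) e'
    = poly_curve D a'.
  apply/funext => h; apply/ffunP => i1.
  by rewrite (@slope_curve_sub _ D a)// ?ffunE// => h'; rewrite ffunE.
apply: IH; last by rewrite /a' mulf_neq0// subr_eq0.
apply: leq_trans bn; apply: proper_card; apply/properP; split.
  apply/fintype.subsetP => -[i1 j1]; rewrite !inE/= => /and3P[-> + ->].
  by rewrite /a' mulf_eq0 negb_or => /andP[_ ->].
exists (i, j); rewrite !inE/= ?iS ?aij//.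
by rewrite /a' [w i * _]mulrC subrr !expr0z subrr mul0r eqxx.
Qed.

Hypothesis wi0 : w i0 < 0.

Lemma linear_neq0 (c : K) : c != 0 -> c *: 'X + 1%:P != 0 :> {poly K}.
Proof.
move=> c0; apply: contraTneq (oner_neq0 K) => /(congr1 (fun p => p.[0])).
by rewrite hornerD hornerZ hornerX mulr0 add0r hornerC horner0 => ->; rewrite eqxx.
Qed.

Lemma one_plus_nonroot (f g : K -> R) : bdd f -> bdd g ->
  (forall h, 1 + h != 0 -> f h = g h) -> m f = m g.
Proof.
move=> bf bg fg.
apply: (mean_off_roots cK hm mshift (linear_neq0 (oner_neq0 K))) => // h.
by rewrite hornerD hornerZ hornerX mul1r hornerC addrC; exact: fg.
Qed.

(** Along b = 1 / (1 + h) the coordinates of negative weight are the polynomials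
(1 + h) ^ |w i| z i, and the linear coefficient at i0 is |w i0| z i0, which is
nonzero because w i0 is nonzero in K. *)
Lemma one_signed (z : V) : z i0 != 0 ->
  (forall i, i \in S -> 0 < w i -> z i = 0) -> phi z = 0.
Proof.
move=> z0 zpos; pose a i j := if w i < 0 then z i * 'C(`|w i|, j)%:R else 0.
pose D := (`|w i0|).+1.
have wi0n : (0 < `|w i0|)%N by rewrite absz_gt0 lt_eqF.
have D1 : (1 < D)%N by rewrite ltnS.
have a1 : a i0 1%N != 0.
  rewrite /a wi0 bin1 mulf_neq0//; have := wK i0S.
  by case: (w i0) wi0 => // k _; rewrite NegzE rmorphN oppr_eq0.
have := poly_curve_mean D1 a1; rewrite /curve_mean => <-.
rewrite -[LHS](mean_cst hm); apply: one_plus_nonroot.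
- exact: bdd_cst.
- exact: posdef_bdd.
move=> h h1; rewrite -(phi_torus (b := (1 + h)^-1)) ?invr_eq0//.
apply: phi_S => i iS; rewrite !ffunE /a.
have := w_neq0 iS; rewrite neq_lt => /orP[wi|wi]; last first.
  by rewrite zpos// mulr0 big1// => j _; rewrite ltNge (ltW wi) mul0r.
have -> : (1 + h)^-1 ^ w i = (1 + h) ^+ `|w i|.
  by case: (w i) wi => // k _; rewrite NegzE -exprnN exprVn invrK.
under eq_bigr do rewrite wi -mulrA.
rewrite -mulr_sumr mulrC; congr (_ * _).
rewrite exprDn.
rewrite (big_ord_widen D (fun j => (1 ^+ (`|w i| - j) * h ^+ j) *+ 'C(`|w i|, j))).
  rewrite big_mkcond/=; apply: eq_bigr => j _; rewrite expr1n mul1r mulr_natl.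
  by case: ltnP => // jw; rewrite bin_small// mulr0n.
by rewrite ltnS wmax.
Qed.

Definition has_pole (f : K -> K) := exists (num den : {poly K}) (r : K),
  [/\ den != 0, den.[r] = 0, num.[r] != 0, r != 0 &
      forall h, den.[h] != 0 -> f h = num.[h] / den.[h]].

(** The transform with parameter e has a pole at r e ^ k; the polynomial P excludes
the values of e for which the transform with parameter e' has one there too. *)
Lemma has_pole_sub (f : K -> K) (k : nat) (j : nat) : (0 < k)%N -> has_pole f ->
  forall e', e' != 0 -> exists P : {poly K}, P != 0 /\
   forall e, e != 0 -> P.[e] != 0 ->
     has_pole (fun h => (e ^+ j) ^ w i0 * f (e ^ (- k%:Z) * h)
                      - (e' ^+ j) ^ w i0 * f (e' ^ (- k%:Z) * h)).
Proof.
move=> k0 [num [den [r [d0 dr nr r0 fE]]]] e' e'0.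
have scale_neq0 (c : K) l (p : {poly K}) : c != 0 -> (0 < l)%N -> p != 0 -> p \Po (c *: 'X^l) != 0.
  move=> c0 l0 p0; rewrite comp_poly_eq0// size_scale// size_polyXn ltnS//.
exists (den \Po ((e' ^ (- k%:Z) * r) *: 'X^k)); split.
  by rewrite scale_neq0// mulf_neq0// expfz_neq0.
move=> e e0; rewrite horner_comp hornerZ hornerXn => de'.
pose c x : K := x ^ (- k%:Z); pose l x : K := (x ^+ j) ^ w i0.
have c0 x : x != 0 -> c x != 0 by move=> x0; rewrite expfz_neq0.
have l0 x : x != 0 -> l x != 0 by move=> x0; rewrite expfz_neq0// expf_neq0.
pose nu x := l x *: (num \Po (c x *: 'X)); pose de x := den \Po (c x *: 'X).
have nuE x h : (nu x).[h] = l x * num.[c x * h].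
  by rewrite hornerZ horner_comp hornerZ hornerX.
have deE x h : (de x).[h] = den.[c x * h] by rewrite horner_comp hornerZ hornerX.
have ce : c e * (r * e ^+ k) = r.
  by rewrite /c -exprnN mulrCA mulVf ?mulr1// expf_neq0.
exists (nu e * de e' - nu e' * de e), (de e * de e'), (r * e ^+ k); split.
- by rewrite mulf_neq0// (scale_neq0 _ 1%N)// c0.
- by rewrite hornerM !deE ce dr mul0r.
- rewrite hornerD hornerN !hornerM !deE !nuE ce dr mulr0 subr0.
  by rewrite !mulf_neq0// ?l0// mulrA.
- by rewrite mulf_neq0// expf_neq0.
- move=> h; rewrite !hornerM mulf_eq0 negb_or !deE => /andP[d1 d2].
  rewrite -/(c e) -/(c e') -/(l e) -/(l e') !fE//.
  rewrite hornerD hornerN !hornerM !deE !nuE; field.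
  by rewrite d1 d2.
Qed.

(** Induction on the number of monomials of positive weight, which are removed as in
[poly_curve_mean].  The pole at i0 persists, so in the end the curve has only
negative weights and a coordinate i0 that vanishes at finitely many h. *)
Lemma mixed_curve_mean D (a : I -> nat -> K) (y : K -> V) :
  (forall i h, i \in S -> 0 < w i -> y h i = \sum_(j < D) a i j * h ^+ j) ->
  has_pole (fun h => y h i0) -> curve_mean y = 0.
Proof.
pose bad (a : I -> nat -> K) : {set I * 'I_D} := ([set ij : I * 'I_D |
  [&& ij.1 \in S, 0 < w ij.1 & a ij.1 ij.2 != 0]])%SET.
have [n] := ubnP #|bad a|; elim: n a y => // n IH a y; rewrite ltnS => bn ya pole.
have [b0|[[i j]]] := set_0Vmem (bad a).
  have [num [den [r [d0 dr nr r0 yE]]]] := pole.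
  have n0 : num != 0 by apply: contraNneq nr => ->; rewrite horner0.
  rewrite -[RHS](mean_cst hm).
  apply: (mean_off_roots cK hm mshift (mulf_neq0 n0 d0)) => [||h].
  - exact: posdef_bdd.
  - exact: bdd_cst.
  rewrite hornerM mulf_eq0 negb_or => /andP[nh dh].
  apply: one_signed; first by rewrite yE// mulf_neq0// invr_eq0.
  move=> i iS wi; rewrite ya// big1// => j _.
  have : (i, j) \notin bad a by rewrite b0 inE.
  by rewrite inE/= iS wi/= => /negPn/eqP ->; rewrite mul0r.
rewrite inE/= => /and3P[iS wi aij].
apply: (generic_orthogonality cK (y := slope_curve (w i) j y) curve_mean_posdef).
  by move=> e e0; exact: curve_mean_slope.
move=> e' e'0.
have wabs : w i = `|w i|%N%:Z by rewrite gtz0_abs.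
have wn0 : (0 < `|w i|)%N by rewrite absz_gt0 gt_eqF.
have [P [P0 Pe]] := has_pole_sub j wn0 pole e'0.
exists P; split=> // e e0 /(Pe _ e0); rewrite -wabs => pole'.
pose a' i1 j1 := (e ^ (j%:Z * w i1 - w i * j1%:Z) - e' ^ (j%:Z * w i1 - w i * j1%:Z)) * a i1 j1.
apply: (IH a').
- apply: leq_trans bn; apply: proper_card; apply/properP; split.
    apply/fintype.subsetP => -[i1 j1]; rewrite !inE/= => /and3P[-> ->].
    by rewrite /a' mulf_eq0 negb_or => /andP[_ ->].
  exists (i, j); rewrite !inE/= ?iS ?wi ?aij//.
  by rewrite /a' [w i * _]mulrC subrr !expr0z subrr mul0r eqxx.
- move=> i1 h i1S wi1; rewrite (@slope_curve_sub _ D a)// => h'; exact: ya.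
- move: pole'; congr has_pole; apply/funext => h.
  by rewrite /slope_curve /torus_curve !ffunE.
Qed.

(** The curve is the orbit of (1, ..., 1) under b = 1 + h; at i0 it has a pole at
h = - 1. *)
Lemma mixing_vanish : phi [ffun=> 1] = 0.
Proof.
pose y (h : K) : V := [ffun i => if 0 < w i then (1 + h) ^+ `|w i| else (1 + h) ^ w i].
pose D := (`|w i0|).+1.
pose a i j : K := 'C(`|w i|, j)%:R.
rewrite -(@mixed_curve_mean D a y).
- rewrite -[LHS](mean_cst hm); apply: one_plus_nonroot.
  + exact: bdd_cst.
  + exact: posdef_bdd.
  move=> h h1; rewrite -(phi_torus (b := 1 + h))//; congr phi; apply/ffunP => i.
  rewrite !ffunE mulr1; case: ifP => // wi.
  by rewrite exprnP gtz0_abs.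
- move=> i h iS wi; rewrite ffunE wi exprDn.
  rewrite (big_ord_widen D (fun j => (1 ^+ (`|w i| - j) * h ^+ j) *+ 'C(`|w i|, j))).
    rewrite big_mkcond/=; apply: eq_bigr => j _; rewrite expr1n mul1r mulr_natl.
    by case: ltnP => // jw; rewrite bin_small// mulr0n.
  by rewrite ltnS wmax.
- exists 1%:P, ((1 *: 'X + 1%:P) ^+ `|w i0|), (-1); split.
  + by rewrite expf_neq0// linear_neq0// oner_neq0.
  + rewrite horner_exp hornerD hornerZ hornerX hornerC mul1r addNr expr0n.
    by rewrite absz_eq0 lt_eqF.
  + by rewrite hornerC oner_neq0.
  + by rewrite oppr_eq0 oner_neq0.
  + move=> h _; rewrite ffunE ltNge (ltW wi0)/= horner_exp hornerD hornerZ hornerX !hornerC !mul1r.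
    by rewrite addrC; case: (w i0) wi0 => // k _; rewrite NegzE -exprnN.
Qed.

End Fixed.
End Torus.

(** * Positivity of torus invariant functions *)

Section Positivity.
Context {R : realType} {K : fieldType} {I : finType}.
Hypothesis cK : ([set: K] #= [set: nat])%card.
Context {m : (K -> R) -> R} (hm : is_mean m).
Hypothesis mshift : forall b f, bdd f -> m (fun x => f (x + b)) = m f.
Hypothesis mscale : forall c f, c != 0 -> bdd f -> m (fun x => f (c * x)) = m f.

Local Notation V := {ffun I -> K}.

Lemma axisB i (x y : K) : axis i (x - y) = axis i x - axis i y :> V.
Proof.
by apply/ffunP => k; rewrite !ffunE; case: ifP => _; rewrite ?subr0.
Qed.

Lemma torus_axis (w : I -> int) i b u :
  torus w b (axis i u) = axis i (b ^ w i * u) :> V.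
Proof.
by apply/ffunP => k; rewrite !ffunE; case: eqP => [->|_]; rewrite ?mulr0.
Qed.

Lemma torusD (w : I -> int) b (y z : V) : torus w b (y + z) = torus w b y + torus w b z.
Proof. by apply/ffunP => k; rewrite !ffunE mulrDr. Qed.

Lemma torusB (w : I -> int) b (y z : V) : torus w b (y - z) = torus w b y - torus w b z.
Proof. by apply/ffunP => k; rewrite !ffunE mulrBr. Qed.

Lemma torusM (w : I -> int) b c (y : V) : torus w b (torus w c y) = torus w (b * c) y.
Proof. by apply/ffunP => k; rewrite !ffunE expfzMl mulrA. Qed.

(** Replacing b by its inverse changes the sign of all weights, so the weight of
maximal absolute value may be assumed negative. *)
Lemma mixing_vanish_max (w : I -> int) (S : {set I}) (i0 : I) (phi : V -> R) :
  posdef phi ->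
  (forall b y, b != 0 -> phi (torus w b y) = phi y) ->
  (forall y y' : V, {in S, y =1 y'} -> phi y = phi y') ->
  i0 \in S -> (forall i, i \in S -> (`|w i| <= `|w i0|)%N) ->
  (forall i, i \in S -> (w i)%:~R != 0 :> K) -> {in S &, injective w} ->
  m (fun u => phi (axis i0 u)) = 0 -> phi [ffun=> 1] = 0.
Proof.
move=> pd ptor pS i0S wmax wK winj mix.
have := w_neq0 wK i0S; rewrite neq_lt => /orP[wi0|wi0].
  exact: (@mixing_vanish R K I cK m hm mshift mscale w S i0).
apply: (@mixing_vanish R K I cK m hm mshift mscale (fun i => - w i) S i0) => //.
- move=> b y b0; rewrite -[RHS](ptor b^-1) ?invr_eq0//; congr phi.
  by apply/ffunP => i; rewrite !ffunE exprz_inv.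
- by move=> i iS; rewrite !abszN; exact: wmax.
- by move=> i iS; rewrite rmorphN oppr_eq0; exact: wK.
- by move=> i j iS jS /oppr_inj; exact: winj.
- by rewrite oppr_lt0.
Qed.

(** Induction on S.  Along the axis of a weight of maximal absolute value, phi is the
sum of its average, which depends on one coordinate less, and of a part with
mean zero, which vanishes at (1, ..., 1). *)
Lemma torus_invariant_ge0 (w : I -> int) (S : {set I}) (phi : V -> R) :
  posdef phi ->
  (forall b y, b != 0 -> phi (torus w b y) = phi y) ->
  (forall y y' : V, {in S, y =1 y'} -> phi y = phi y') ->
  (forall i, i \in S -> (w i)%:~R != 0 :> K) -> {in S &, injective w} ->
  0 <= phi [ffun=> 1].
Proof.
have [n] := ubnP #|S|; elim: n S phi => // n IH S phi; rewrite ltnS => Sn.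
move=> pd ptor pS wK winj.
have [S0|[j jS]] := set_0Vmem S.
  rewrite (pS _ 0); first exact: posdef0_ge0.
  by move=> i; rewrite S0 inE.
case: (@arg_maxnP _ j (mem S) (fun i => `|w i|%N) jS) => i0 i0S' wmax.
have i0S : i0 \in S by exact: i0S'.
pose psi := avg_along m (axis i0) phi.
have axB := axisB i0.
have psd : posdef psi := avg_along_posdef hm mshift mscale axB pd.
have dsd : posdef (fun y => phi y - psi y) := sub_avg_along_posdef hm mshift mscale axB pd.
have psi_tor b y : b != 0 -> psi (torus w b y) = psi y.
  move=> b0; rewrite /psi /avg_along.
  rewrite -(mscale (c := b ^ w i0)) ?expfz_neq0//; last exact: posdef_bdd.
  by congr m; apply/funext => u; rewrite -torus_axis -torusD ptor.
have psi_S (y y' : V) : {in S, y =1 y'} -> psi y = psi y'.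
  move=> yy'; congr m; apply/funext => u; apply: pS => i iS.
  by rewrite !ffunE yy'.
rewrite -(subrK (psi [ffun=> 1]) (phi _)).
rewrite (@mixing_vanish_max w S i0 (fun y => phi y - psi y))//.
- rewrite add0r; apply: (IH (S :\ i0)%SET) => //.
  + by rewrite (leq_trans _ Sn)// [leqRHS](cardsD1 i0) i0S.
  + move=> y y' yy'; rewrite -[RHS](avg_along_shift mshift axB pd y' (y i0 - y' i0)).
    apply: psi_S => i iS; rewrite !ffunE; case: eqP => [->|/eqP ii0].
      by rewrite addrC subrK.
    by rewrite addr0 yy'// !inE ii0.
  + by move=> i; rewrite !inE => /andP[_]; exact: wK.
  + by move=> i k; rewrite !inE => /andP[_ iS] /andP[_ kS]; exact: winj.
- by move=> b y b0; rewrite ptor// psi_tor.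
- by move=> y y' yy'; rewrite (pS y y')// (psi_S y y').
- have -> : (fun u => phi (axis i0 u) - psi (axis i0 u)) =
            (fun u => phi (0 + axis i0 u) - psi 0).
    apply/funext => u; rewrite add0r; congr (_ - _).
    rewrite -[RHS](avg_along_shift mshift axB pd 0 u).
    by rewrite add0r.
  rewrite (meanB hm); [|exact: posdef_bdd|exact: bdd_cst].
  by rewrite (mean_cst hm) subrr.
Qed.

End Positivity.

(** * Linearization of Laurent polynomials *)

Section LaurentMap.
Context {K : fieldType}.

(** The exponent k is factored into its prime-to-characteristic part, with sign, and
the part q for which x |-> x ^ q is a power of Frobenius; in characteristic 0,
q = 1. *)
Lemma pchar_split (k : int) : k != 0 -> exists (k1 : int) (q : nat),
  [/\ k = k1 * q%:Z, (`|k1| <= `|k|)%N, k1%:~R != 0 :> K &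
      forall x y : K, (x - y) ^+ q = x ^+ q - y ^+ q].
Proof.
move=> k0; have kn : (0 < `|k|)%N by rewrite absz_gt0.
exists ((-1) ^+ (k < 0)%R * (partn `|k| [pchar K]^')%N%:Z), (partn `|k| [pchar K])%N.
have pn : [pchar K].-nat (partn `|k| [pchar K])%N by exact: part_pnat.
split.
- by rewrite {1}[k]intEsign -mulrA -PoszM mulnC partnC.
- rewrite abszMsign absz_nat -[leqRHS](partnC [pchar K] kn).
  by rewrite leq_pmull// part_gt0.
- rewrite rmorphM rmorphXn rmorphN1 mulf_neq0//; first by rewrite expf_neq0// oppr_eq0 oner_eq0.
  have : ([pchar K]^')%N.-nat (partn `|k| [pchar K]^')%N by exact: part_pnat.
  by rewrite -natf_neq0_pchar.
- by move=> x y; rewrite exprDn_pchar// exprNn_pchar.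
Qed.

(** [pchar_split] for all exponents of a Laurent polynomial at once, in terms of the
indices i of the exponents i - N. *)
Lemma laurent_core (N : nat) : exists (c : 'I_N.*2.+1 -> 'I_N.*2.+1) (q : 'I_N.*2.+1 -> nat),
  forall i : 'I_N.*2.+1, (i%:Z - N%:Z : int) != 0 ->
  [/\ i%:Z - N%:Z = ((c i)%:Z - N%:Z) * (q i)%:Z, ((c i)%:Z - N%:Z)%:~R != 0 :> K &
   forall x y : K, (x - y) ^+ q i = x ^+ q i - y ^+ q i].
Proof.
have /choice[f fP] : forall i : 'I_N.*2.+1, exists cq : 'I_N.*2.+1 * nat,
    (i%:Z - N%:Z : int) != 0 ->
  [/\ i%:Z - N%:Z = (cq.1%:Z - N%:Z) * (cq.2)%:Z, (cq.1%:Z - N%:Z)%:~R != 0 :> K &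
   forall x y : K, (x - y) ^+ cq.2 = x ^+ cq.2 - y ^+ cq.2].
  move=> i; have [->|w0] := eqVneq (i%:Z - N%:Z) 0; first by exists (i, 0%N).
  have [k1 [q [kE k1le k10 qB]]] := pchar_split w0.
  have k1N : (absz (k1 + N%:Z)%R < N.*2.+1)%N by have := ltn_ord i; lia.
  have k1E : (absz (k1 + N%:Z)%R)%:Z - N%:Z = k1 by have := ltn_ord i; lia.
  by exists (Ordinal k1N, q) => _ /=; rewrite k1E.
by exists (fun i => (f i).1), (fun i => (f i).2).
Qed.

End LaurentMap.

(** * Correlations and the theorem *)

Section Correlation.
Context {R : realType} {K : fieldType}.

(** By translation invariance the Gram form is the mean of a square. *)
Lemma correlation_posdef (L : (K -> R) -> R) (f : K -> R) : is_mean L ->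
  (forall b f, bdd f -> L (fun x => f (x + b)) = L f) -> bdd f ->
  posdef (fun y => L (fun x => f x * f (x + y))).
Proof.
move=> hL Linv bf; have [C hC] := bf.
have b2 (u v : K) : bdd (fun x => f (x + u) * f (x + v)).
  by exists (C * C) => x; rewrite normrM ler_pM.
have b1 (v : K) : bdd (fun x => f x * f (x + v)).
  by exists (C * C) => x; rewrite normrM ler_pM.
split=> [y|s].
  rewrite -(Linv y)//; congr L; apply/funext => x.
  by rewrite addrK mulrC.
have -> : gram (fun y => L (fun x => f x * f (x + y))) s =
          L (fun x => (\sum_(p <- s) p.1 * f (x + p.2)) ^+ 2).
  rewrite /gram.
  under eq_bigr => p _.
    under eq_bigr => q _.
      rewrite -(Linv q.2)// -(meanZ hL); last exact: (bdd_comp (fun x => x + q.2) (b1 _)).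
      over.
    rewrite -(mean_sum hL); last first.
      by move=> q; apply: bddZ; exact: (bdd_comp (fun x => x + q.2) (b1 _)).
    over.
  rewrite -(mean_sum hL); last first.
    move=> p; apply: bdd_sum => q; apply: bddZ.
    exact: (bdd_comp (fun x => x + q.2) (b1 _)).
  congr L; apply/funext => x; rewrite expr2 mulr_suml; apply: eq_bigr => p _.
  rewrite mulr_sumr; apply: eq_bigr => q _.
  by rewrite -addrA [q.2 + _]addrC subrK; ring.
apply: (mean_ge0 hL) => [|x]; last exact: sqr_ge0.
have [D hD] : bdd (fun x => \sum_(p <- s) p.1 * f (x + p.2)).
  by apply: bdd_sum => p; apply: bddZ; exact: (bdd_comp (fun x => x + p.2)).
by exists (D * D) => x; rewrite normrX expr2 ler_pM.
Qed.

End Correlation.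

Theorem theorem1p34 (R : realType) (K : fieldType)
    (K_countably_infinite : ([set: K] #= [set: nat])%card)
    (E : set K) (E_pos : (0 < upper_banach_density R E)%E)
    (N : nat) (p : int -> K) (p0 : p 0 = 0) :
  exists a : K, a != 0 /\ difference_set E (laurent_eval N p a).
Proof.
have [_ [F Ffolner <-] Fpos] := ereal_sup_gt E_pos.
have [L [hL Linv L1]] := folner_mean Ffolner Fpos.
have [m [hm mshift mscale]] := affine_mean K_countably_infinite hL Linv.
have [mu [hmu muscale mueq]] := @multiplicative_mean R K K_countably_infinite.
apply: contrapT => noa.
set one := fun x : K => (x \in E)%:R : R.
have bone : bdd one by exists 1 => x; rewrite ger0_norm ?ler0n// lern1 leq_b1.
pose d := L one; pose f x := one x - d.
have bf : bdd f by apply: bddB => //; exact: bdd_cst.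
have := correlation_posdef hL Linv bf.
set phi0 := fun y => L _ => pd0.
pose I := 'I_N.*2.+1; pose w (i : I) : int := i%:Z - N%:Z.
have [c [q cqP]] := laurent_core (K := K) N.
pose S : {set I} := ([set c i | i : I & w i != 0])%SET.
pose ell (y : {ffun I -> K}) : K := \sum_(i : I | w i != 0) p (w i) * y (c i) ^+ q i.
have ellB y z : ell (y - z) = ell y - ell z.
  rewrite /ell -sumrB; apply: eq_bigr => i wi; rewrite !ffunE.
  by have [_ _ ->] := cqP i wi; rewrite mulrBr.
have ell1 b : b != 0 -> ell (torus w b [ffun=> 1]) = laurent_eval N p b.
  move=> b0; rewrite /ell /laurent_eval [RHS](bigID (fun i : I => w i != 0))/=.
  rewrite [X in _ = _ + X]big1 ?addr0; last first.
    by move=> i /negPn/eqP; rewrite /w => ->; rewrite p0 mul0r.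
  apply: eq_bigr => i wi; rewrite !ffunE mulr1; congr (_ * _).
  have [wE _ _] := cqP i wi.
  by rewrite [in RHS]wE exprnP exprz_exp.
pose phi y := mu (fun b => phi0 (ell (torus w b y))).
have bphi y : bdd (fun b => phi0 (ell (torus w b y))) by exact: posdef_bdd.
have pd : posdef phi.
  apply: (posdef_mean (phi := fun b y => phi0 (ell (torus w b y))) hmu) => // b.
  apply: (posdef_pull (h := fun y => ell (torus w b y))) pd0 => y z.
  by rewrite torusB ellB.
have phi_tor b y : b != 0 -> phi (torus w b y) = phi y.
  move=> b0; rewrite /phi -[RHS](muscale b)//; congr mu; apply/funext => x.
  by rewrite torusM mulrC.
have phi_S (y y' : {ffun I -> K}) : {in S, y =1 y'} -> phi y = phi y'.
  move=> yy'; congr mu; apply/funext => b; congr phi0.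
  apply: eq_bigr => i wi; rewrite !ffunE yy'//.
  by apply/imsetP; exists i; rewrite ?inE.
have := @torus_invariant_ge0 R K I K_countably_infinite m hm mshift mscale w S phi pd phi_tor phi_S.
suff -> : phi [ffun=> 1] = - d ^+ 2.
  have d2 : 0 < d ^+ 2 by rewrite exprn_gt0.
  rewrite oppr_ge0 leNgt d2 => h; have : false; last by [].
  apply: h.
    by move=> k /imsetP[i]; rewrite inE => wi ->; have [_ h1 _] := cqP i wi.
  move=> i j _ _ wij; apply: val_inj => /=.
  by move: wij; rewrite /w => /addIr[].
(* for b <> 0 the sets E and E - p(b) are disjoint, so that the correlation of
   1_E - d at p(b) is - 2 d ^ 2 + d ^ 2 *)
rewrite -[RHS](mean_cst hmu); apply: mueq => b b0.
rewrite ell1// /phi0 /f; set pb := laurent_eval N p b.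
have disj x : one x * one (x + pb) = 0.
  rewrite /one; have [xE|] := boolP (x \in E); last by rewrite mul0r.
  have [xpE|] := boolP (x + pb \in E); last by rewrite mulr0.
  exfalso; apply: noa; exists b; split=> //.
  exists (x + pb); first by rewrite -in_setE.
  by exists x; [rewrite -in_setE|rewrite addrC addKr].
rewrite (_ : (fun x => _) = (fun x => (- d) * (one x + one (x + pb)) + d ^+ 2)); last first.
  by apply/funext => x; rewrite mulrBl !mulrBr disj; ring.
have bs : bdd (fun x => one (x + pb)) by exact: (bdd_comp (fun x => x + pb)).
rewrite (meanD hL); [|by apply: bddZ; exact: bddD|exact: bdd_cst].
rewrite (meanZ hL); last exact: bddD.
by rewrite (meanD hL)// Linv// (mean_cst hL) -/d; ring.
Qed.
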